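(* Let $C$ be a finite dimensional coalgebra over an algebraically closed field $\mathbb{K}$ of characteristic zero, with comultiplication $\Delta$ and counit $\varepsilon$, and let $D:C\to C$ be an automorphism of coalgebras of finite order $m$. Let $r\in\mathbb{K}$ be an element of multiplicative order $2m$ if $m$ is even and of multiplicative order $m$ if $m$ is odd, and let $q=r^2$. Let $\mathcal{E}=\{0\le i\le m-1: q^i\in\operatorname{Spec}(D)\}$ and, for $i\in\mathcal{E}$, $E_{D,q^i}=\{x\in C: Dx=q^ix\}$. For each $i\in\mathcal{E}$ take an arbitrary direct sum decomposition into subspaces $E_{D,q^i}=V_{+,i}\oplus V_{-,i}$, and define the linear transformation $\sigma$ on $C$ by $\sigma|_{V_{\pm,i}}=\pm r^i\operatorname{id}$ for all $i\in\mathcal{E}$. Then $\sigma^2=D$. Moreover, $\sigma$ is an automorphism of coalgebras if and only if the following conditions hold: (1) $\varepsilon(V_{-,0})=0$; (2) for all $i\in\mathcal{E}$, if $m$ is even: $$\Delta(V_{+,i})\subseteq\bigoplus_{\{a,b\in\mathcal{E}:\,a+b=i\}}(V_{+,a}\otimes V_{+,b}+V_{-,a}\otimes V_{-,b})\ \oplus\bigoplus_{\{a,b\in\mathcal{E}:\,a+b=i+m\}}(V_{+,a}\otimes V_{-,b}+V_{-,a}\otimes V_{+,b}),$$ $$\Delta(V_{-,i})\subseteq\bigoplus_{\{a,b\in\mathcal{E}:\,a+b=i\}}(V_{+,a}\otimes V_{-,b}+V_{-,a}\otimes V_{+,b})\ \oplus\bigoplus_{\{a,b\in\mathcal{E}:\,a+b=i+m\}}(V_{+,a}\otimes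 V_{+,b}+V_{-,a}\otimes V_{-,b}),$$ and if $m$ is odd: $$\Delta(V_{+,i})\subseteq\bigoplus_{\{a,b\in\mathcal{E}:\,a+b=i\}}(V_{+,a}\otimes V_{+,b}+V_{-,a}\otimes V_{-,b})\ \oplus\bigoplus_{\{a,b\in\mathcal{E}:\,a+b=i+m\}}(V_{+,a}\otimes V_{+,b}+V_{-,a}\otimes V_{-,b}),$$ $$\Delta(V_{-,i})\subseteq\bigoplus_{\{a,b\in\mathcal{E}:\,a+b=i\}}(V_{+,a}\otimes V_{-,b}+V_{-,a}\otimes V_{+,b})\ \oplus\bigoplus_{\{a,b\in\mathcal{E}:\,a+b=i+m\}}(V_{+,a}\otimes V_{-,b}+V_{-,a}\otimes V_{+,b}).$$
   Context: Coalgebras are coassociative and counital, and automorphisms of coalgebras preserve the counit. $\operatorname{Spec}(D)$ is the set of eigenvalues of $D$. If $0\notin\mathcal{E}$ one sets $V_{\pm,0}=\{0\}$. Note that $q$ has order $m$ and $C=\bigoplus_{i\in\mathcal{E}}E_{D,q^i}$, so $\sigma$ is well defined. *)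

(* Defs.v *)
From HB Require Import structures.
From mathcomp Require Import all_boot all_algebra.

Set Implicit Arguments.
Unset Strict Implicit.
Unset Printing Implicit Defensive.

Import GRing.Theory.
Import passmx.
Local Open Scope ring_scope.

(* The tensor product of two finite dimensional spaces is modelled by matrices
   of coordinates.  [tensor_liftE] and [tensor_ext] are its universal property;
   [tensorv_subP] characterizes the tensor product of two subspaces. *)
Section Tensor.
Variables (K : fieldType) (U V : vectType K).

Definition tensor : vectType K := 'M[K]_(\dim {:U}, \dim {:V}).

Definition tens (u : U) (v : V) : tensor :=
  \matrix_(i, j) (coord (vbasis {:U}) i u * coord (vbasis {:V}) j v).

(* The linear map u ⊗ v |-> b u v; only meaningful when b is bilinear. *)
Definition tensor_lift (W : vectType K) (b : U -> V -> W) : 'Hom(tensor, W) :=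
  linfun (fun t : 'M[K]_(\dim {:U}, \dim {:V}) =>
    \sum_i \sum_j t i j *: b (vbasis {:U})`_i (vbasis {:V})`_j).

Definition tensorv (A : {vspace U}) (B : {vspace V}) : {vspace tensor} :=
  <<[seq tens a b | a <- vbasis A, b <- vbasis B]>>%VS.

End Tensor.

Notation "u ⊗ v" := (tens u v) (at level 40, left associativity) : ring_scope.
Notation "A ⊗ B" := (tensorv A B)
  (at level 40, left associativity) : vspace_scope.

Section TensorTheory.
Variables (K : fieldType) (U V W : vectType K).

Lemma tens_linear_l (v : V) : linear (fun u : U => u ⊗ v).
Proof.
by move=> c u u'; apply/matrixP => i j; rewrite !mxE linearP mulrDl -mulrA.
Qed.

Lemma tens_linear_r (u : U) : linear (fun v : V => u ⊗ v).
Proof.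
by move=> c v v'; apply/matrixP => i j; rewrite !mxE linearP mulrDr mulrCA.
Qed.

Lemma tensor_liftE (b : U -> V -> W) (u : U) (v : V) :
    (forall y, linear (b^~ y)) -> (forall x, linear (b x)) ->
  tensor_lift b (u ⊗ v) = b u v.
Proof.
move=> bl br; rewrite /tensor_lift; set f := (X in linfun X).
have flin : linear f.
  move=> c s t; rewrite /f scaler_sumr -big_split; apply: eq_bigr => i _.
  rewrite scaler_sumr -big_split; apply: eq_bigr => j _ /=.
  by rewrite !mxE scalerDl scalerA.
pose fM := GRing.isLinear.Build _ _ _ _ f flin.
pose F : {linear _ -> _} := HB.pack f fM.
rewrite (lfunE F) /= /f.
have lin0 (A : vectType K) (g : A -> W) : linear g -> g 0 = 0.
  by move=> gl; have := gl (-1) 0 0; rewrite scaler0 addr0 scaleN1r addNr.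
have linS (A : vectType K) (g : A -> W) n (c : 'I_n -> K) (e : 'I_n -> A) :
    linear g -> g (\sum_i c i *: e i) = \sum_i c i *: g (e i).
  move=> gl; elim/big_ind2: _ => //; first exact: lin0.
    by move=> x x' y y' <- <-; rewrite -[x in x + _]scale1r gl scale1r.
  by move=> i _; rewrite -[c i *: _]addr0 gl lin0 // addr0.
rewrite [u in RHS](coord_vbasis (memvf u)) (linS _ (b^~ v)) //=.
apply: eq_bigr => i _.
rewrite [v in RHS](coord_vbasis (memvf v)) (linS _ (b _)) // scaler_sumr.
by apply: eq_bigr => j _; rewrite mxE scalerA.
Qed.

Lemma tensor_ext (f g : 'Hom(tensor U V, W)) :
  (forall u v, f (u ⊗ v) = g (u ⊗ v)) -> f = g.
Proof.
move=> fg; apply/lfunP => t; rewrite [t]matrix_sum_delta !linear_sum.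
apply: eq_bigr => i _; rewrite !linear_sum; apply: eq_bigr => j _.
suff -> : delta_mx i j = (vbasis {:U})`_i ⊗ (vbasis {:V})`_j.
  by rewrite !linearZ /= fg.
apply/matrixP => k l; rewrite !mxE !coord_free ?(basis_free (vbasisP _)) //.
by rewrite -natrM mulnb eq_sym (eq_sym l).
Qed.

Lemma tensorv_subP (A : {vspace U}) (B : {vspace V})
    (S : {vspace tensor U V}) :
  reflect (forall a b, a \in A -> b \in B -> a ⊗ b \in S) (A ⊗ B <= S)%VS.
Proof.
apply: (iffP span_subvP) => [AB a b aA bB | AB t /allpairsP[[a b] /= [aA bB ->]]];
  last by apply: AB; apply: vbasis_mem.
have -> : a = \sum_i coord (vbasis A) i a *: (vbasis A)`_i by exact: coord_vbasis.
pose lM (y : V) := GRing.isLinear.Build _ _ _ _ (fun x : U => x ⊗ y) (tens_linear_l y).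
pose rM (x : U) := GRing.isLinear.Build _ _ _ _ (fun y : V => x ⊗ y) (tens_linear_r x).
pose l y : {linear U -> tensor U V} := HB.pack (fun x : U => x ⊗ y) (lM y).
pose r x : {linear V -> tensor U V} := HB.pack (fun y : V => x ⊗ y) (rM x).
rewrite -[_ ⊗ b]/(l b _) linear_sum; apply: memv_suml => i _.
rewrite linearZ memvZ //= {1}(coord_vbasis bB) -[_ ⊗ _]/(r _ _) linear_sum.
apply: memv_suml => j _; rewrite linearZ memvZ //=; apply: AB.
by apply: allpairs_f; apply: mem_nth; rewrite size_tuple.
Qed.

End TensorTheory.

Definition tensor_map (K : fieldType) (U V U' V' : vectType K)
    (f : 'Hom(U, U')) (g : 'Hom(V, V')) : 'Hom(tensor U V, tensor U' V') :=
  tensor_lift (fun u v => f u ⊗ g v).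

(* The canonical isomorphisms (U ⊗ V) ⊗ W ~ U ⊗ (V ⊗ W), K ⊗ V ~ V, V ⊗ K ~ V. *)
Definition tensor_assoc (K : fieldType) (U V W : vectType K) :
    'Hom(tensor (tensor U V) W, tensor U (tensor V W)) :=
  tensor_lift (fun t w => tensor_lift (fun u v => u ⊗ (v ⊗ w)) t).

Definition tensor_unitl (K : fieldType) (V : vectType K) :
    'Hom(tensor K^o V, V) := tensor_lift (fun (a : K^o) v => (a : K) *: v).

Definition tensor_unitr (K : fieldType) (V : vectType K) :
    'Hom(tensor V K^o, V) := tensor_lift (fun v (a : K^o) => (a : K) *: v).

Section Coalgebra.
Variables (K : fieldType) (C : vectType K).
Variables (Delta : 'Hom(C, tensor C C)) (eps : 'Hom(C, K^o)).

Definition is_coalgebra : Prop :=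
  [/\ (tensor_assoc C C C \o (tensor_map Delta \1 \o Delta))%VF
        = (tensor_map \1 Delta \o Delta)%VF,
      (tensor_unitl C \o (tensor_map eps \1 \o Delta))%VF = \1%VF
    & (tensor_unitr C \o (tensor_map \1 eps \o Delta))%VF = \1%VF].

Definition is_coalg_aut (f : 'End(C)) : Prop :=
  [/\ bijective f,
      (Delta \o f)%VF = (tensor_map f f \o Delta)%VF
    & (eps \o f)%VF = eps].

End Coalgebra.

Definition has_finite_order (T : Type) (f : T -> T) (m : nat) : Prop :=
  [/\ (0 < m)%N, iter m f =1 id
    & forall k, (0 < k < m)%N -> ~ iter k f =1 id].

Section Grading.
Variables (K : fieldType) (C : vectType K).

Definition spec_exponents (D : 'End(C)) (q : K) (m : nat) : pred nat :=
  [pred i | (i < m)%N && leigenvalue D (q ^+ i)].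

(* When Vp a and Vm a decompose the eigenspaces of D, the sums below are
   direct, because eigenspaces for distinct eigenvalues are independent. *)
Variables (E : pred nat) (m : nat) (Vp Vm : nat -> {vspace C}).

Definition same_sign_part (s : nat) : {vspace tensor C C} :=
  (\sum_(a < m | E a) \sum_(b < m | E b && (a + b == s)%N)
     (Vp a ⊗ Vp b + Vm a ⊗ Vm b))%VS.

Definition opp_sign_part (s : nat) : {vspace tensor C C} :=
  (\sum_(a < m | E a) \sum_(b < m | E b && (a + b == s)%N)
     (Vp a ⊗ Vm b + Vm a ⊗ Vp b))%VS.

End Grading.

Lemma sqr_prim_root (K : fieldType) (m : nat) (r : K) :
    (0 < m)%N -> (if odd m then m else (2 * m)%N).-primitive_root r ->
  m.-primitive_root (r ^+ 2).
Proof.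
move=> m_gt0; case: ifP => m_odd rP.
  by rewrite (prim_root_exp_coprime _ rP) coprime2n.
by have := dvdn_prim_root rP (dvdn_mull 2 (dvdnn m)); rewrite mulnK.
Qed.

Section SigmaWellDefined.
Variables (K : fieldType) (C : vectType K) (D : 'End(C)) (m : nat) (q r : K).
Variables (Vp Vm : nat -> {vspace C}).
Hypotheses (char0 : [pchar K] =i pred0) (qP : m.-primitive_root q).
Hypothesis DP : has_finite_order D m.
Let E := spec_exponents D q m.
Hypothesis EV : forall i, i \in E ->
  directv (Vp i + Vm i) /\ (Vp i + Vm i)%VS = leigenspace D (q ^+ i).

Lemma mem_leigenspace (f : 'End(C)) (a : K) x :
  (x \in leigenspace f a) = (f x == a *: x).
Proof.
by rewrite memv_ker add_lfunE opp_lfunE scale_lfunE id_lfunE subr_eq0.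
Qed.

Let P (i : nat) : 'End(C) :=
  m%:R^-1 *: \sum_(k < m) (q^-1 ^+ (i * k)) *: linfun (iter k D).

Let m_gt0 : (0 < m)%N. Proof. by case: DP. Qed.
Let m_neq0 : m%:R != 0 :> K.
Proof. by rewrite (pcharf0P _).1 // -lt0n. Qed.
Let q_neq0 : q != 0.
Proof. by apply: contraTneq m_gt0 => q0; have := prim_expr_order qP;
  rewrite q0 expr0n; case: (m) => //= n /eqP; rewrite eq_sym oner_eq0. Qed.

Let iter_lin k : linear (iter k D).
Proof. by elim: k => [//|k IH] c x y; rewrite !iterS (IH c) linearP. Qed.

Let PE i x : P i x = m%:R^-1 *: \sum_(k < m) (q^-1 ^+ (i * k)) *: iter k D x.
Proof.
rewrite scale_lfunE sum_lfunE; congr (_ *: _); apply: eq_bigr => k _.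
rewrite scale_lfunE.
pose fM := GRing.isLinear.Build _ _ _ _ (iter k D) (iter_lin k).
pose F : {linear _ -> _} := HB.pack (iter k D) fM.
by rewrite (lfunE F).
Qed.

Let geom i j : (i < m)%N -> (j < m)%N ->
  \sum_(k < m) (q ^+ i / q ^+ j) ^+ k = if i == j then m%:R else 0.
Proof.
move=> im jm; have qj : q ^+ j != 0 by rewrite expf_neq0.
case: eqP => [->|/eqP ij].
  by rewrite divff // (eq_bigr (fun=> 1)) ?sumr_const ?card_ord // => k _;
    rewrite expr1n.
have z1 : q ^+ i / q ^+ j != 1.
  apply: contra_neq ij => zz; have : q ^+ i == q ^+ j.
    by rewrite -(divfK qj (q ^+ i)) zz mul1r.
  by rewrite (eq_prim_root_expr qP) !modn_small // => /eqP.
have := subrX1 (q ^+ i / q ^+ j) m.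
rewrite expr_div_n -!exprM ![(_ * m)%N]mulnC !exprM (prim_expr_order qP).
rewrite !expr1n divr1 subrr => /esym /eqP.
by rewrite mulf_eq0 subr_eq0 (negPf z1) => /eqP.
Qed.

Let sumP x : \sum_(i < m) P i x = x.
Proof.
under eq_bigr do rewrite PE.
rewrite -scaler_sumr exchange_big /= (bigD1 (Ordinal m_gt0)) //=.
rewrite [X in _ + X]big1 => [|k k0].
  rewrite addr0 (eq_bigr (fun=> x)) => [|i _]; last by rewrite muln0 scale1r.
  by rewrite sumr_const card_ord -scaler_nat scalerA mulVf // scale1r.
rewrite -scaler_suml (eq_bigr (fun i : 'I_m => (q ^+ 0 / q ^+ k) ^+ i)).
  by rewrite geom // eq_sym -val_eqE in k0 *; rewrite (negPf k0) scale0r.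
by move=> i _; rewrite expr0 div1r -exprVn -exprM mulnC.
Qed.

Let P_eig i x : P i x \in leigenspace D (q ^+ i).
Proof.
rewrite mem_leigenspace PE linearZ scalerA mulrC -scalerA /=.
apply/eqP; congr (_ *: _); rewrite linear_sum scaler_sumr.
pose F k := (q^-1 ^+ (i * k) * q ^+ i) *: iter k D x.
rewrite (eq_bigr (fun k : 'I_m => F k.+1)) => [|k _]; last first.
  rewrite linearZ /= /F mulnS exprD mulrAC (exprVn q i).
  by rewrite mulVf ?mul1r // expf_neq0.
rewrite [RHS](eq_bigr (fun k : 'I_m => F k)) => [|k _]; last first.
  by rewrite scalerA mulrC.
have Fm : F m = F 0%N.
  have [_ Dm _] := DP.
  by rewrite /F Dm muln0 mulnC exprM exprVn (prim_expr_order qP) invr1 expr1n.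
case: m Fm => [|n] Fm; first by rewrite !big_ord0.
by rewrite big_ord_recr [RHS]big_ord_recl /= Fm addrC.
Qed.

Let P_id i j x : (i < m)%N -> (j < m)%N -> x \in leigenspace D (q ^+ i) ->
  P j x = if i == j then x else 0.
Proof.
move=> im jm; rewrite mem_leigenspace => /eqP Dx; rewrite PE.
rewrite (eq_bigr (fun k : 'I_m => (q ^+ i / q ^+ j) ^+ k *: x)).
  rewrite -scaler_suml geom //; case: eqP => _; last by rewrite scale0r scaler0.
  by rewrite scalerA mulVf // scale1r.
move=> k _; have -> : iter k D x = (q ^+ i) ^+ k *: x.
  by elim: (k : nat) => [|n IH] /=; rewrite ?scale1r // IH linearZ /= Dx scalerA exprSr.
by rewrite scalerA mulrC exprMn !exprVn -!exprM.
Qed.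

Lemma sigma_well_defined : exists! sigma : 'End(C),
  forall i, i \in E ->
    (forall x, x \in Vp i -> sigma x = r ^+ i *: x) /\
    (forall x, x \in Vm i -> sigma x = - r ^+ i *: x).
Proof.
pose pi i := (daddv_pi (Vp i) (Vm i) - daddv_pi (Vm i) (Vp i))%R.
pose sigma := (\sum_(i < m | E i) r ^+ i *: (pi i \o P i)%VF).
have sE i x : i \in E -> x \in leigenspace D (q ^+ i) ->
    sigma x = r ^+ i *: pi i x.
  move=> iE xE; have im : (i < m)%N by case/andP: (iE).
  rewrite /sigma sum_lfunE (bigD1 (Ordinal im)) //= big1 => [|j /andP[_ ji]].
    by rewrite addr0 scale_lfunE comp_lfunE (P_id im im xE) eqxx.
  rewrite scale_lfunE comp_lfunE (P_id im (ltn_ord j) xE) eq_sym.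
  by rewrite -val_eqE /= in ji; rewrite (negPf ji) linear0 scaler0.
exists sigma; split => [i iE | tau tauP].
  have [/directv_addP pm0 pmE] := EV iE; have mp0 := pm0; rewrite capvC in mp0.
  have other A B y : (A :&: B)%VS = 0%VS -> y \in A -> daddv_pi B A y = 0.
    move=> AB yA; apply: (addrI (daddv_pi A B y)).
    by rewrite daddv_pi_add ?addr0 ?daddv_pi_id // (subvP (addvSl A B)).
  split=> x xV; rewrite (sE i) -?pmE // ?add_lfunE ?opp_lfunE.
  - by rewrite daddv_pi_id // other // subr0.
  - by rewrite (subvP (addvSl _ _)).
  - by rewrite other // daddv_pi_id // sub0r scalerN scaleNr.
  - by rewrite (subvP (addvSr _ _)).
apply/lfunP => x; rewrite -(sumP x) !linear_sum; apply: eq_bigr => i _ /=.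
have [iE|iE] := boolP ((i : nat) \in E); last first.
  have /eqP E0 : leigenspace D (q ^+ i) == 0%VS.
    by apply: contraR iE => nz; rewrite inE /= ltn_ord.
  by have := P_eig i x; rewrite E0 memv0 => /eqP ->; rewrite !linear0.
have [/directv_addP pm0 pmE] := EV iE; have [tp tm] := tauP _ iE.
rewrite (sE _ _ iE (P_eig i x)) add_lfunE opp_lfunE.
have := P_eig i x; rewrite -pmE => /(daddv_pi_add pm0).
have := memv_pi (Vp i) (Vm i) (P i x); have := memv_pi (Vm i) (Vp i) (P i x).
move: (daddv_pi _ _ _) (daddv_pi _ _ _) => u v vm up uv.
by rewrite -[in RHS]uv [RHS]linearD /= (tp _ up) (tm _ vm) scalerBr scaleNr.
Qed.

End SigmaWellDefined.

(* Main.v *)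
Require Import Defs.
From mathcomp Require Import all_boot all_algebra.
Import GRing.Theory passmx.
Local Open Scope ring_scope.

(** Write [W s i] for the summand of sign [(-1)^s] in the [q^i]-eigenspace of
    [D].  Since [D] has finite order, it is diagonalizable, so the [W s i] span
    [C]; on [W s i] the map [sigma] is the scalar [lambda s i = (-1)^s r^i],
    whose square is [q^i].  Hence [sigma] squares to [D] ([sigma_sqr]), and in
    particular it is bijective.

    The tensor square of [sigma] is in turn diagonal for the decomposition of
    the tensor square of [C] into the products [W u a ⊗ W v b], with eigenvalue
    [(-1)^(u + v) r^(a + b)].  When is this equal to [(-1)^s r^i]?  Squaring
    gives [q^(a + b) = q^i], so [a + b] is [i] or [i + m], because [q] has
    order [m].  In the first case the signs must satisfy [u + v = s].  In the
    second the factor [r^m] enters: it is [1] for [m] odd, and [-1] for [m]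
    even, where [r] has order [2m].  This is the only source of the difference
    between the two parities.  So the right-hand sides of condition (2) are
    exactly the eigenspaces of the tensor square of [sigma]
    ([leigenspace_tensor_sigma]).  Condition (2) therefore says that [Delta]
    sends each [W s i] into the eigenspace with the same eigenvalue, which is
    compatibility of [sigma] with [Delta] tested on the spanning family [W s i]
    ([sigma_comult_parts]).

    For the counit, [eps \o D = eps] forces [eps] to vanish on the eigenspaces
    with [i != 0].  On [W false 0] the map [sigma] is the identity, and on
    [W true 0] it is [-1], so that [eps \o sigma = eps] reduces to condition (1)
    ([sigma_counit]). *)

Set Implicit Arguments.
Unset Strict Implicit.

(** * Eigenspaces of an endomorphism diagonal on a spanning family *)

Section Eigenspaces.
Variables (K : fieldType) (U : vectType K).

(** Independence of eigenvectors, without assuming the [a j] distinct: applying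
    [f - a k] removes the term [k] and multiplies the sum by the nonzero scalar
    [mu - a k], which allows induction on the number of terms. *)
Lemma eigen_sum_eq0 (f : 'End(U)) (mu : K) (J : eqType) (s : seq J)
    (a : J -> K) (x : J -> U) :
    (forall j, j \in s -> a j != mu /\ f (x j) = a j *: x j) ->
    f (\sum_(j <- s) x j) = mu *: (\sum_(j <- s) x j) ->
  \sum_(j <- s) x j = 0.
Proof.
elim: s x => [|k s IH] x ax fx; first by rewrite big_nil.
have [ak fk] := ax k (mem_head k s).
have {}ax j : j \in s -> a j != mu /\ f (x j) = a j *: x j.
  by move=> js; apply: ax; rewrite inE js orbT.
pose y j := (a j - a k) *: x j.
have yE : \sum_(j <- s) y j = (mu - a k) *: \sum_(j <- k :: s) x j.
  rewrite scalerBl -fx !big_cons linearD /= fk scalerDr opprD addrACA subrr add0r.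
  rewrite scaler_sumr linear_sum -sumrB !big_seq; apply: eq_bigr => j js.
  by have [_ /= ->] := ax j js; rewrite /y scalerBl.
have : \sum_(j <- s) y j = 0.
  apply: IH => [j js|].
    have [aj fj] := ax j js.
    by split=> //; rewrite /y linearZ /= fj !scalerA mulrC.
  by rewrite yE linearZ /= fx !scalerA mulrC.
move/eqP; rewrite yE scaler_eq0 subr_eq0 eq_sym (negPf ak) => /eqP //.
Qed.

(** The components of an eigenvector whose eigenvalue differs from [mu] add up
    to an eigenvector for [mu], which is zero by [eigen_sum_eq0]. *)
Lemma leigenspace_sub_sum (f : 'End(U)) (J : finType) (P : pred J)
    (a : J -> K) (A : J -> {vspace U}) (mu : K) :
    (forall j, P j -> (A j <= leigenspace f (a j))%VS) ->
    (\sum_(j | P j) A j)%VS = fullv ->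
  (leigenspace f mu <= \sum_(j | P j && (a j == mu)) A j)%VS.
Proof.
move=> fA spanA; apply/subvP => t; rewrite mem_leigenspace => /eqP ft.
have : t \in (\sum_(j | P j) A j)%VS by rewrite spanA memvf.
case/memv_sumP => x xA tE.
have fx j : P j -> f (x j) = a j *: x j.
  by move=> Pj; apply/eqP; rewrite -mem_leigenspace (subvP (fA j Pj)) ?xA.
have tE2 : t = \sum_(j | P j && (a j == mu)) x j
             + \sum_(j | P j && (a j != mu)) x j.
  by rewrite tE (bigID (fun j => a j == mu)).
have rest0 : \sum_(j | P j && (a j != mu)) x j = 0.
  rewrite -big_filter; apply: (@eigen_sum_eq0 f mu _ _ a x) => [j|].
    by rewrite mem_filter => /andP[/andP[/fx]].
  rewrite big_filter; apply: (addrI (mu *: \sum_(j | P j && (a j == mu)) x j)).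
  rewrite -scalerDr -tE2 -ft [in RHS]tE2 linearD; congr (_ + _).
  rewrite scaler_sumr linear_sum; apply: eq_bigr => j /andP[Pj /eqP <-].
  by rewrite /= fx.
rewrite tE2 rest0 addr0; apply: memv_suml => j /andP[Pj aj].
by apply: (subvP (sumv_sup j _ (subvv _))); rewrite ?Pj ?aj ?xA.
Qed.

Lemma eq_lfun_on_sum (W : vectType K) (J : finType) (P : pred J)
    (A : J -> {vspace U}) (f g : 'Hom(U, W)) :
    (\sum_(j | P j) A j)%VS = fullv ->
    (forall j x, P j -> x \in A j -> f x = g x) ->
  f = g.
Proof.
move=> spanA fg; apply/lfunP => u.
have : u \in (\sum_(j | P j) A j)%VS by rewrite spanA memvf.
case/memv_sumP => x xA ->; rewrite !linear_sum; apply: eq_bigr => j Pj.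
by apply: fg Pj (xA j Pj).
Qed.

End Eigenspaces.

(** * Tensor products of spanning families *)

Section TensorSums.
Variables (K : fieldType) (U V : vectType K).

Lemma tens_suml (J : finType) (P : pred J) (x : J -> U) (v : V) :
  (\sum_(j | P j) x j) ⊗ v = \sum_(j | P j) x j ⊗ v.
Proof.
apply/matrixP => i k; rewrite summxE mxE linear_sum mulr_suml.
by apply: eq_bigr => j _; rewrite mxE.
Qed.

Lemma tens_sumr (J : finType) (P : pred J) (u : U) (y : J -> V) :
  u ⊗ (\sum_(j | P j) y j) = \sum_(j | P j) u ⊗ y j.
Proof.
apply/matrixP => i k; rewrite summxE mxE linear_sum mulr_sumr.
by apply: eq_bigr => j _; rewrite mxE.
Qed.

Lemma tensZZ (a b : K) (u : U) (v : V) : (a *: u) ⊗ (b *: v) = (a * b) *: (u ⊗ v).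
Proof. by apply/matrixP => i k; rewrite !mxE !linearZ /= mulrACA. Qed.

Lemma mem_tensorv (A : {vspace U}) (B : {vspace V}) u v :
  u \in A -> v \in B -> u ⊗ v \in (A ⊗ B)%VS.
Proof. by move=> uA vB; apply: (tensorv_subP _ _ _ (subvv (A ⊗ B)%VS)). Qed.

(** By the uniqueness part of the universal property, the projection onto [S]
    is the identity as soon as it fixes the pure tensors. *)
Lemma tensor_fullv (S : {vspace tensor U V}) :
  (forall u v, u ⊗ v \in S) -> S = fullv.
Proof.
move=> allS; have /lfunP S1 : \1%VF = projv S.
  by apply: tensor_ext => u v; rewrite id_lfunE projv_id.
by apply/vspaceP => t; rewrite memvf -[t]id_lfunE S1 memv_proj.
Qed.

Lemma tensorv_sum_full (I J : finType) (P : pred I) (Q : pred J)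
    (A : I -> {vspace U}) (B : J -> {vspace V}) :
    (\sum_(i | P i) A i)%VS = fullv -> (\sum_(j | Q j) B j)%VS = fullv ->
  (\sum_(p : I * J | P p.1 && Q p.2) A p.1 ⊗ B p.2)%VS = fullv.
Proof.
move=> spanA spanB; apply: tensor_fullv => u v.
have : u \in (\sum_(i | P i) A i)%VS by rewrite spanA memvf.
case/memv_sumP => x xA ->.
have : v \in (\sum_(j | Q j) B j)%VS by rewrite spanB memvf.
case/memv_sumP => y yB ->.
rewrite tens_suml; apply: memv_suml => i Pi; rewrite tens_sumr.
apply: memv_suml => j Qj.
apply: (subvP (sumv_sup (i, j) _ (subvv _))); first by rewrite Pi Qj.
by apply: mem_tensorv; [apply: xA | apply: yB].
Qed.

Lemma tensor_mapE (U' V' : vectType K) (f : 'Hom(U, U')) (g : 'Hom(V, V')) u v :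
  tensor_map f g (u ⊗ v) = f u ⊗ g v.
Proof.
apply: (tensor_liftE (b := fun x y => f x ⊗ g y)) => [y|x] c z z'.
  by rewrite linearP tens_linear_l.
by rewrite linearP tens_linear_r.
Qed.

Lemma tensorv_sub_leigenspace (f : 'End(U)) (g : 'End(V)) (a b : K)
    (A : {vspace U}) (B : {vspace V}) :
    (A <= leigenspace f a)%VS -> (B <= leigenspace g b)%VS ->
  (A ⊗ B <= leigenspace (tensor_map f g) (a * b))%VS.
Proof.
move=> fA gB; apply/tensorv_subP => u v /(subvP fA) + /(subvP gB).
rewrite !mem_leigenspace tensor_mapE => /eqP -> /eqP ->.
by rewrite tensZZ.
Qed.

End TensorSums.

(** * Parts of the tensor square sorted by sign *)

Section Sign.
Variables (K : fieldType) (C : vectType K) (E : pred nat) (m : nat).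
Variables (Vp Vm : nat -> {vspace C}).

(** Signs are booleans, [true] for minus, so that multiplying signs is [(+)]
    and the sign itself is [(-1) ^+ s]. *)
Definition signed_part (s : bool) (i : nat) : {vspace C} :=
  if s then Vm i else Vp i.

Definition parity_part (s : bool) (n : nat) : {vspace tensor C C} :=
  if s then opp_sign_part E m Vp Vm n else same_sign_part E m Vp Vm n.

Lemma tensorv_sub_parity_part (a b : 'I_m) (s t : bool) :
    E a -> E b ->
  (signed_part s a ⊗ signed_part t b <= parity_part (s (+) t) (a + b))%VS.
Proof.
move=> Ea Eb; case: s t => [] [];
  rewrite /signed_part /parity_part /=;
  apply: (sumv_sup a) => //; apply: (sumv_sup b); rewrite ?Eb ?eqxx //;
  by rewrite ?addvSl ?addvSr.
Qed.

Lemma parity_part_sub (s : bool) (n : nat) (S : {vspace tensor C C}) :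
    (forall a b u v, (a < m)%N -> (b < m)%N -> E a -> E b -> (a + b)%N = n ->
       u (+) v = s -> (signed_part u a ⊗ signed_part v b <= S)%VS) ->
  (parity_part s n <= S)%VS.
Proof.
move=> sub; rewrite /parity_part; case: s sub => sub;
  apply/subv_sumP => a Ea; apply/subv_sumP => b /andP[Eb /eqP ab];
  rewrite subv_add.
  by rewrite (sub a b false true) ?(sub a b true false).
by rewrite (sub a b false false) ?(sub a b true true).
Qed.

End Sign.

(** This sign is what separates the two parities of [m]: only when [m] is even
    does the order [2 * m] of [r] make [r ^+ m] a nontrivial square root of 1. *)
Lemma prim_root_expr_half (K : fieldType) (m : nat) (r : K) :
    (0 < m)%N -> (if odd m then m else (2 * m)%N).-primitive_root r ->
  r ^+ m = (-1) ^+ (~~ odd m).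
Proof.
move=> m_gt0; case: ifP => m_odd rP; first by rewrite (prim_expr_order rP).
have /eqP := prim_expr_order rP; rewrite mulnC exprM sqrf_eq1 => /orP[|/eqP //].
rewrite -(prim_order_dvd rP) => /(dvdn_leq m_gt0).
by rewrite mul2n -addnn -[X in (_ <= X)%N]addn0 leq_add2l leqNgt m_gt0.
Qed.

(** * The square root of the automorphism *)

Section SquareRoot.
Variables (K : fieldType) (K_char0 : [pchar K] =i pred0) (C : vectType K).
Variables (D : 'End(C)) (m : nat) (D_order : has_finite_order D m) (r : K).
Hypothesis r_order : (if odd m then m else (2 * m)%N).-primitive_root r.
Let E := spec_exponents D (r ^+ 2) m.
Variables (Vp Vm : nat -> {vspace C}).
Hypothesis V_decomp : forall i, i \in E ->
  directv (Vp i + Vm i) /\ (Vp i + Vm i)%VS = leigenspace D ((r ^+ 2) ^+ i).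
Variable sigma : 'End(C).
Hypothesis sigma_def : forall i, i \in E ->
  (forall x, x \in Vp i -> sigma x = r ^+ i *: x) /\
  (forall x, x \in Vm i -> sigma x = - r ^+ i *: x).

Let W := signed_part Vp Vm.
Let lambda (s : bool) (i : nat) : K := (-1) ^+ s * r ^+ i.

Let m_gt0 : (0 < m)%N. Proof. by case: D_order. Qed.
Let qP : m.-primitive_root (r ^+ 2). Proof. exact: sqr_prim_root. Qed.

Let r_neq0 : r != 0.
Proof.
apply/eqP => r0; have := prim_expr_order qP.
by rewrite r0 expr0n /= expr0n gtn_eqF //= => /eqP; rewrite eq_sym oner_eq0.
Qed.

Let N1_neq1 : (-1 : K) != 1.
Proof.
rewrite eq_sym -subr_eq0 opprK; have := (pcharf0P _).1 K_char0 2.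
by rewrite mulr2n => ->.
Qed.

Lemma sigma_signed_part i s x :
  i \in E -> x \in W s i -> sigma x = lambda s i *: x.
Proof.
move=> /sigma_def[sp sm]; rewrite /lambda; case: s => [/sm|/sp] -> //.
  by rewrite mulN1r.
by rewrite mul1r.
Qed.

(** The conditions defining [sigma] determine it uniquely.  If the signed parts
    did not span, a nonzero map vanishing on all of them could be added to
    [sigma] without affecting these conditions. *)
Lemma signed_parts_span :
  (\sum_(p : 'I_m * bool | E p.1) W p.2 p.1)%VS = fullv.
Proof.
set S := (\sum_(p | _) _)%VS.
have WS i s x : i \in E -> x \in W s i -> x \in S.
  move=> iE xW; have im : (i < m)%N by case/andP: (iE).
  by apply: (subvP (sumv_sup (Ordinal im, s) _ (subvv _)) _ xW).
(* A projection whose kernel is S. *)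
pose h : 'End(C) := (\1 - projv S)%VF.
have h0 x : x \in S -> h x = 0.
  by move=> xS; rewrite add_lfunE opp_lfunE id_lfunE projv_id // subrr.
have [tau [_ tau_uniq]] := sigma_well_defined r K_char0 qP D_order V_decomp.
have /tau_uniq sE := sigma_def.
have /tau_uniq : forall i, i \in E ->
    (forall x, x \in Vp i -> (sigma + h) x = r ^+ i *: x) /\
    (forall x, x \in Vm i -> (sigma + h) x = - r ^+ i *: x).
  move=> i iE; have [sp sm] := sigma_def iE.
  split=> x xV; rewrite add_lfunE h0 ?addr0.
  - exact: sp.
  - exact: (WS i false).
  - exact: sm.
  - exact: (WS i true).
rewrite sE -[X in X = _]addr0 => /addrI /esym /lfunP hE.
apply/vspaceP => x; rewrite memvf; have /eqP := hE x.
rewrite zero_lfunE add_lfunE opp_lfunE id_lfunE subr_eq0 => /eqP ->.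
exact: memv_proj.
Qed.

Lemma signed_part_eigen i s x :
  i \in E -> x \in W s i -> D x = (r ^+ 2) ^+ i *: x.
Proof.
move=> /V_decomp[_ VE] xW; apply/eqP; rewrite -mem_leigenspace -VE.
by case: s xW; apply: subvP; rewrite ?addvSr ?addvSl.
Qed.

Lemma sigma_sqr : (sigma \o sigma)%VF = D.
Proof.
apply: (eq_lfun_on_sum signed_parts_span) => -[i s] x iE xW.
rewrite comp_lfunE (sigma_signed_part iE xW) linearZ /= (sigma_signed_part iE xW).
rewrite (signed_part_eigen iE xW) scalerA.
by rewrite /lambda mulrACA -signr_addb addbb mul1r -exprMn -expr2.
Qed.

(** The right-hand sides of condition (2), for both parities of [m] and both
    signs at once: passing from [a + b = i] to [a + b = i + m] multiplies the
    eigenvalue by [r ^+ m], which shifts the sign by [~~ odd m]. *)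
Lemma leigenspace_tensor_sigma i s : (i < m)%N ->
  leigenspace (tensor_map sigma sigma) (lambda s i)
  = (parity_part E m Vp Vm s i
     + parity_part E m Vp Vm (s (+) ~~ odd m) (i + m))%VS.
Proof.
move=> im; have rm := prim_root_expr_half m_gt0 r_order.
have Weig j u : j \in E -> (W u j <= leigenspace sigma (lambda u j))%VS.
  move=> jE; apply/subvP => x xW.
  by rewrite mem_leigenspace (sigma_signed_part jE xW).
have lambdaM a b u v : lambda u a * lambda v b = lambda (u (+) v) (a + b)%N.
  by rewrite /lambda mulrACA -signr_addb -exprD.
have lambda_inj u v n : lambda u n = lambda v n -> u = v.
  move/(mulIf (expf_neq0 n r_neq0)); case: u v => [] [] //= /eqP.
    by rewrite expr1 (negPf N1_neq1).
  by rewrite eq_sym expr1 (negPf N1_neq1).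
have lambda_addm u n : lambda (u (+) ~~ odd m) (n + m) = lambda u n.
  by rewrite /lambda exprD rm mulrCA -signr_addb -addbA addbb addbF mulrC.
have part_sub u n : (parity_part E m Vp Vm u n
    <= leigenspace (tensor_map sigma sigma) (lambda u n))%VS.
  apply: parity_part_sub => a b v w am bm Ea Eb <- <-; rewrite -lambdaM.
  by apply: tensorv_sub_leigenspace; apply: Weig.
apply/eqP; rewrite eqEsubv; apply/andP; split; last first.
  by rewrite subv_add part_sub -[X in leigenspace _ X](lambda_addm s) part_sub.
have spanT := tensorv_sum_full signed_parts_span signed_parts_span.
have Teig (p : ('I_m * bool) * ('I_m * bool)) : E p.1.1 && E p.2.1 ->
    (W p.1.2 p.1.1 ⊗ W p.2.2 p.2.1
     <= leigenspace (tensor_map sigma sigma)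
          (lambda p.1.2 p.1.1 * lambda p.2.2 p.2.1))%VS.
  by case/andP=> aE bE; apply: tensorv_sub_leigenspace; apply: Weig.
apply: (subv_trans (leigenspace_sub_sum _ Teig spanT)).
apply/subv_sumP => -[[a u] [b v]] /= /andP[/andP[aE bE]].
rewrite lambdaM => /eqP eql.
apply: (subv_trans (tensorv_sub_parity_part Vp Vm u v aE bE)).
(* Squaring forgets the sign and determines a + b modulo m. *)
have sqr w n : lambda w n ^+ 2 = (r ^+ 2) ^+ n.
  by rewrite /lambda exprMn sqrr_sign mul1r -!exprM mulnC.
have /eqP : (r ^+ 2) ^+ (a + b) = (r ^+ 2) ^+ i by rewrite -(sqr (u (+) v)) eql sqr.
rewrite (eq_prim_root_expr qP) (modn_small im) => /eqP abi.
have [ab_lt|ab_ge] := ltnP (a + b) m.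
  move: abi; rewrite modn_small // => abi.
  by rewrite abi in eql *; rewrite (lambda_inj _ _ _ eql) addvSl.
have {}abi : (a + b)%N = (i + m)%N.
  rewrite -(subnK ab_ge); congr (_ + _)%N; rewrite -abi -[in RHS](subnK ab_ge).
  rewrite modnDr modn_small // ltn_subLR //.
  by rewrite -addSn leq_add // ltnW.
rewrite abi -(lambda_addm s) in eql *.
by rewrite (lambda_inj _ _ _ eql) addvSr.
Qed.

(** On [W s i] the map [Delta \o sigma] is [lambda s i *: Delta], so commutation
    there means that [Delta] takes values in an eigenspace, which
    [leigenspace_tensor_sigma] identifies. *)
Lemma sigma_comult_parts (Delta : 'Hom(C, tensor C C)) :
  (Delta \o sigma)%VF = (tensor_map sigma sigma \o Delta)%VF <->
  forall i s, i \in E ->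
    (Delta @: W s i <= parity_part E m Vp Vm s i
       + parity_part E m Vp Vm (s (+) ~~ odd m) (i + m))%VS.
Proof.
have comm i s x : i \in E -> x \in W s i ->
    (Delta x \in leigenspace (tensor_map sigma sigma) (lambda s i))
    = ((tensor_map sigma sigma \o Delta)%VF x == (Delta \o sigma)%VF x).
  move=> iE xW; rewrite mem_leigenspace !comp_lfunE.
  by rewrite (sigma_signed_part iE xW) linearZ.
split=> [DT i s iE | sub].
  have im : (i < m)%N by case/andP: (iE).
  rewrite -(leigenspace_tensor_sigma s im); apply/subvP => _ /memv_imgP[x xW ->].
  by rewrite (comm i s) // DT.
apply: (eq_lfun_on_sum signed_parts_span) => -[i s] x iE xW.
apply/esym/eqP; rewrite -(comm i s) // leigenspace_tensor_sigma //.
by apply: (subvP (sub i s iE)); apply: memv_img.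
Qed.

(** Only the eigenvalue 1 of [D] matters, since [eps x = q ^+ i * eps x] on the
    [q ^+ i]-eigenspace.  The sign counts because [-1 != 1] in [K]. *)
Lemma sigma_counit (eps : 'Hom(C, K^o)) :
    (eps \o D)%VF = eps -> (0%N \notin E -> Vm 0%N = 0%VS) ->
  (eps \o sigma)%VF = eps <-> forall x, x \in Vm 0%N -> eps x = 0.
Proof.
move=> epsD V0; split=> [epsS x xV | eps0].
  have [E0|/V0 Vm0] := boolP (0%N \in E); last first.
    by move: xV; rewrite Vm0 memv0 => /eqP ->; rewrite linear0.
  have := congr1 (fun f : 'Hom(C, K^o) => f x) epsS.
  rewrite comp_lfunE (sigma_signed_part (s := true) E0 xV) linearZ /= /lambda mulr1.
  move/eqP; rewrite -subr_eq0 -[X in _ - X]scale1r -scalerBl scaler_eq0.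
  by rewrite subr_eq0 (negPf N1_neq1) => /eqP.
apply: (eq_lfun_on_sum signed_parts_span) => -[[i im] s] x /= iE xW.
rewrite comp_lfunE (sigma_signed_part iE xW) linearZ /= /lambda.
case: i im iE xW => [|i] im iE xW.
  by case: s xW => [/eps0 ->|_]; rewrite ?scaler0 // mulr1 scale1r.
suff -> : eps x = 0 by rewrite scaler0.
have := congr1 (fun f : 'Hom(C, K^o) => f x) epsD.
rewrite comp_lfunE (signed_part_eigen iE xW) linearZ /=.
move/eqP; rewrite -subr_eq0 -[X in _ - X]scale1r -scalerBl scaler_eq0.
rewrite subr_eq0 -[X in _ == X](expr0 (r ^+ 2)) (eq_prim_root_expr qP).
by rewrite mod0n modn_small // => /eqP.
Qed.

End SquareRoot.

Lemma bijective_of_sqr (T : Type) (f : T -> T) :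
  bijective (f \o f) -> bijective f.
Proof.
case=> g ffK gK; exists (g \o f) => [x | x] /=; first exact: ffK.
by apply: (can_inj (g := g \o f) ffK); apply: gK.
Qed.

Unset Implicit Arguments.
Set Strict Implicit.

Theorem theorem5p3
  (K : closedFieldType) (K_char0 : [pchar K] =i pred0)
  (C : vectType K) (Delta : 'Hom(C, tensor C C)) (eps : 'Hom(C, K^o))
  (C_coalg : is_coalgebra Delta eps)
  (D : 'End(C)) (D_aut : is_coalg_aut Delta eps D)
  (m : nat) (D_order : has_finite_order D m)
  (r : K)
  (r_order : (if odd m then m else (2 * m)%N).-primitive_root r)
  (q : K) (q_def : q = r ^+ 2)
  (E : pred nat) (E_def : E = spec_exponents D q m)
  (Vp Vm : nat -> {vspace C})
  (V_decomp : forall i, i \in E ->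
     directv (Vp i + Vm i) /\ (Vp i + Vm i)%VS = leigenspace D (q ^+ i))
  (V_conv0 : 0%N \notin E -> Vp 0%N = 0%VS /\ Vm 0%N = 0%VS)
  (sigma : 'End(C))
  (sigma_def : forall i, i \in E ->
     (forall x, x \in Vp i -> sigma x = r ^+ i *: x) /\
     (forall x, x \in Vm i -> sigma x = - r ^+ i *: x)) :
  (sigma \o sigma)%VF = D /\
  (is_coalg_aut Delta eps sigma <->
     (forall x, x \in Vm 0%N -> eps x = 0) /\
     (forall i, i \in E ->
        if odd m then
          (Delta @: Vp i <= same_sign_part E m Vp Vm i
                            + same_sign_part E m Vp Vm (i + m))%VS /\
          (Delta @: Vm i <= opp_sign_part E m Vp Vm i
                            + opp_sign_part E m Vp Vm (i + m))%VS
        else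
          (Delta @: Vp i <= same_sign_part E m Vp Vm i
                            + opp_sign_part E m Vp Vm (i + m))%VS /\
          (Delta @: Vm i <= opp_sign_part E m Vp Vm i
                            + same_sign_part E m Vp Vm (i + m))%VS)).
Proof.
subst q E.
have sqr := sigma_sqr K_char0 D_order r_order V_decomp sigma_def.
split=> //.
have [D_bij _ epsD] := D_aut.
have sigma_bij : bijective sigma.
  by apply: bijective_of_sqr; apply: (eq_bij D_bij) => x; rewrite -sqr comp_lfunE.
have comult := sigma_comult_parts K_char0 D_order r_order V_decomp sigma_def Delta.
have counit := sigma_counit K_char0 D_order r_order V_decomp sigma_def epsD
  (fun E0 => (V_conv0 E0).2).
split=> [[_ /comult parts /counit eps0] | [eps0 parts]].
  split=> // i iE; have := parts i true iE; have := parts i false iE.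
  by rewrite /parity_part /signed_part; case: (odd m).
split=> //; last exact/counit.
apply/comult => i s iE; have := parts i iE.
by rewrite /parity_part /signed_part; case: (odd m) => -[]; case: s.
Qed.
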